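(* Let $q\ge2$ be an integer and $f$ a mock character of mockulus $q$. Suppose that $f(p)\neq0$ for some prime $p$ dividing $q$. Then $q=p^m$ for some integer $m\ge1$, and $f$ is a mock character of mockulus $p$.
   Context: For an integer $q\ge2$, a sequence $(\alpha(n))_{n\ge0}$ is $q$-automatic if its $q$-kernel $\{(\alpha(q^km+r))_{m\ge0}: k\ge0,\ 0\le r<q^k\}$ is a finite set (of sequences). A map $\kappa:\mathbb{Z}\to\mathbb{C}$ is a mock character of mockulus $q$ if (i) $\kappa$ is completely multiplicative; (ii) the sequence $(\kappa(n))_{n\ge0}$ is $q$-automatic but not eventually periodic; and (iii) there exists an integer $d\ge1$ such that $\kappa(n)=0$ precisely when $n=0$ or $\gcd(n,d)\neq1$. *)

(* Defs.v *)
From HB Require Import structures.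
From mathcomp Require Import all_boot all_order all_algebra.
From mathcomp Require Import classical_sets cardinality reals.
From mathcomp Require Export complex.

Set Implicit Arguments.
Unset Strict Implicit.
Unset Printing Implicit Defensive.

Import Order.TTheory GRing.Theory Num.Theory.

Local Open Scope classical_set_scope.
Local Open Scope ring_scope.

Definition kernel_seq (T : Type) (q : nat) (a : nat -> T) : set (nat -> T) :=
  [set b | exists k r : nat,
     (r < q ^ k)%N /\ b = (fun m : nat => a (q ^ k * m + r)%N)].

Definition automatic (T : Type) (q : nat) (a : nat -> T) : Prop :=
  finite_set (kernel_seq q a).

Definition eventually_periodic (T : Type) (a : nat -> T) : Prop :=
  exists N t : nat, (0 < t)%N /\ forall n : nat, (N <= n)%N -> a (n + t)%N = a n.

(* [monoid_morphism kappa] is complete multiplicativity: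
   [kappa 1 = 1] and [kappa (m * n) = kappa m * kappa n] for all [m n : int]. *)
Definition mock_character (R : realType) (q : nat) (kappa : int -> R[i]) : Prop :=
  [/\ monoid_morphism kappa,
      automatic q (fun n : nat => kappa n%:Z),
      ~ eventually_periodic (fun n : nat => kappa n%:Z)
    & exists d : nat, (1 <= d)%N /\
        forall n : int, kappa n = 0 <-> n = 0 \/ gcdz n d%:Z <> 1].

(* Main.v *)
(** Write q = p^a b with b coprime to p, and suppose b > 1. As f(p) is nonzero,
    q-automaticity controls the blocks f(Mx + y), y < M, for every M dividing a
    power q^k with cofactor a power of p: up to finitely many classes they do
    not depend on x. Such M include b^j b^t p^s for all large j, and, p and b
    being multiplicatively independent, two numbers u < v of the form b^t p^s
    have ratio arbitrarily close to 1. If x < x' lie in the same class, then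
    shifting f by M(x' - x) and by M'(x' - x), for M = b^j u and M' = b^j v,
    changes nothing on a long interval, so that f has the short local period
    (M' - M)(x' - x) there. As in Krebs's proof of Cobham's theorem, these
    overlapping local periods merge into a period of f, which is excluded.
    Hence b = 1, and f(p) <> 0 turns the p^a-kernel into the p-kernel. *)
Require Import Defs.
From HB Require Import structures.
From mathcomp Require Import all_boot all_order all_algebra.
From mathcomp Require Import boolp classical_sets cardinality reals.
From mathcomp Require Import zify.

Set Implicit Arguments.
Unset Strict Implicit.
Unset Printing Implicit Defensive.

Import Order.TTheory GRing.Theory Num.Theory.

Local Open Scope nat_scope.

Definition periodic_on (T : Type) (f : nat -> T) (P lo hi : nat) : Prop :=
  forall n, lo <= n -> n + P < hi -> f (n + P) = f n.

(** Once [n + P] reaches [hi], both [n] and [n + P] are moved down by [Q]. The overlap has length at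
    least [P + Q], so [n - Q] stays at or above [lo'] and induction applies. *)
Lemma periodic_on_merge (T : Type) (f : nat -> T) (P Q lo lo' hi hi' : nat) :
  0 < Q -> lo <= lo' -> lo' + P + Q <= hi ->
  periodic_on f P lo hi -> periodic_on f Q lo' hi' -> periodic_on f P lo hi'.
Proof.
move=> Q0 lolo' olap perP perQ n; elim/ltn_ind: n => n IH lon nhi'.
have [nhi|hin] := ltnP (n + P) hi; first exact: perP.
have nE : n = n - Q + Q by lia.
have nPE : n + P = n - Q + P + Q by lia.
rewrite nPE perQ; [|lia|lia].
rewrite IH; [|lia|lia|lia].
by rewrite [in RHS]nE perQ //; lia.
Qed.

Lemma fin_values_bound (F : finType) (W : nat -> F) :
  exists L : nat, forall y, exists2 x, x < L & W x = W y.
Proof.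
have [e eP] : {e : F -> nat & forall y, W (e (W y)) = W y}.
  suff /choice[e eP] : forall w : F, exists x, forall y, W y = w -> W x = w.
    by exists e => y; apply: (eP _ y).
  move=> w; have [[y <-]|nw] := pselect (exists y, W y = w); first by exists y.
  by exists 0 => y Wy; case: nw; exists y.
exists (\max_(w : F) (e w).+1) => y; exists (e (W y)) => //.
exact: (leq_bigmax (W y)).
Qed.

(** Each [f (q ^ k * x + y)] is the value at [x] of a kernel sequence, so [V x] need only record the
    values at [x] of the finitely many kernel sequences. *)
Lemma automatic_classes (T : eqType) (q : nat) (f : nat -> T) :
  1 < q -> automatic q f ->
  exists (F : finType) (V : nat -> F), forall x x', V x = V x' ->
    forall k y, y < q ^ k -> f (q ^ k * x + y) = f (q ^ k * x' + y).
Proof.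
move=> q1 /finite_seqP[s sE].
have inK k y : y < q ^ k -> (fun n => f (q ^ k * n + y)) \in s.
  move=> yq; have : [set` s]%classic (fun n => f (q ^ k * n + y)).
    by rewrite -sE; exists k, y.
  by [].
(* Since [x < q ^ x], every [f x] is the value at 0 of a kernel sequence; hence [f] takes finitely
   many values, and [V] can store their indices. *)
pose vals := [seq g 0 | g : nat -> T <- s].
have valsP x : f x \in vals.
  apply/mapP; exists (fun n => f (q ^ x * n + x)).
    exact/inK/ltn_expl.
  by rewrite muln0.
pose V x : {ffun 'I_(size s) -> 'I_(size vals).+1} :=
  [ffun i : 'I_(size s) => inord (index (nth f s i x) vals)].
exists {ffun 'I_(size s) -> 'I_(size vals).+1}, V => x x' VE k y yq.
have gs := inK _ _ yq; set g := (X in X \in s) in gs.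
have is_ : index g s < size s by rewrite index_mem.
have /(congr1 val) := congr1 (fun h : {ffun _ -> _} => h (Ordinal is_)) VE.
rewrite !ffunE /= nth_index // !inordK ?ltnS ?index_size // => iE.
by have := congr1 (nth (f 0) vals) iE; rewrite /g !nth_index.
Qed.

Lemma periodic_of_blocks (T : Type) (F : finType) (f : nat -> T)
    (W : nat -> F) (b : nat) (good : nat -> Prop) :
  1 < b ->
  (forall M, good M -> forall x x', W x = W x' ->
    forall y, y < 3 * M -> f (M * x + y) = f (M * x' + y)) ->
  (forall E, exists u v j0, [/\ 0 < u, u < v, E * (v - u) <= u &
    forall j, j0 <= j -> good (b ^ j * u) /\ good (b ^ j * v)]) ->
  eventually_periodic f.
Proof.
move=> b1 blocks ratio; have [L LP] := fin_values_bound W.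
(* With this [B], the last interval at scale [j] ends at [M j * (B + 3)], beyond [M j.+1 * (L + 2)],
   so it overlaps the first interval of scale [j.+1] in length more than [M j.+1]. *)
pose B := b * (L + 2).
have LB : L <= B by rewrite /B; nia.
have [u [v [j0 [u0 uv Euv goodP]]]] := ratio (2 * B).
pose M j := b ^ j * u.
have bj0 j : 0 < b ^ j by rewrite expn_gt0; lia.
have M0 j : 0 < M j by rewrite muln_gt0 bj0.
have MS j : M j.+1 = b * M j by rewrite /M expnS mulnA.
(* Both [f n] and [f (n + D * h)] equal [f (n - M j * h)], by block lengths [M j] and [M j + D].
   Starting at [x'.+1] leaves room for the offset [D * x]; [L <= x'] forces [x < x']. *)
have loc j x' : j0 <= j -> L <= x' <= B -> exists P,
    [/\ 0 < P, 2 * P <= M j & periodic_on f P (M j * x'.+1) (M j * (x' + 3))].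
  move=> jj0 /andP[Lx' x'B]; have [x xL Wx] := LP x'.
  have [gu gv] := goodP _ jj0.
  pose D := b ^ j * (v - u).
  have D0 : 0 < D by rewrite muln_gt0 bj0 subn_gt0.
  have DM : b ^ j * v = M j + D by rewrite /M /D -mulnDr subnKC // ltnW.
  have ED : 2 * (B * D) <= M j.
    by rewrite mulnA /D mulnCA leq_mul2l Euv orbT.
  have x'E : x' = x + (x' - x) by lia.
  have h0 : 0 < x' - x by lia.
  set h := x' - x in h0 x'E.
  have hB : h <= B by lia.
  have Dh : D * h <= B * D by rewrite mulnC leq_mul2r hB orbT.
  have Dx : D * x <= B * D by rewrite mulnC leq_mul2r; apply/orP; right; lia.
  exists (D * h); split; [by rewrite muln_gt0 D0 | by lia |].
  move=> n lon nhi.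
  have := blocks _ gu _ _ Wx; have := blocks _ gv _ _ Wx.
  rewrite DM -/(M j) => bv bu.
  have MD : (M j + D) * x = M j * x + D * x by rewrite mulnDl.
  have MDh : (M j + D) * h = M j * h + D * h by rewrite mulnDl.
  have Mx' : M j * x' = M j * x + M j * h by rewrite x'E mulnDr.
  have MDx' : (M j + D) * x' = (M j + D) * x + (M j + D) * h.
    by rewrite x'E mulnDr.
  have Mx'S : M j * x'.+1 = M j * x' + M j by rewrite mulnS addnC.
  have Mx'3 : M j * (x' + 3) = M j * x' + 3 * M j.
    by rewrite mulnDr (mulnC 3).
  have yu : n - M j * x' < 3 * M j by lia.
  have yv : n - M j * h - (M j + D) * x < 3 * (M j + D) by lia.
  have := bu _ yu; have := bv _ yv.
  have -> : (M j + D) * x + (n - M j * h - (M j + D) * x) =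
            M j * x + (n - M j * x') by lia.
  have -> : (M j + D) * x' + (n - M j * h - (M j + D) * x) = n + D * h by lia.
  have -> : M j * x' + (n - M j * x') = n by lia.
  by move=> <- ->.
(* This [P] is kept for good; each later [Q] only extends its range. *)
have [P [P0 PM perP]] := loc j0 L (leqnn _) (introT andP (conj (leqnn L) LB)).
pose lo := M j0 * L.+1.
have Mmono j : j0 <= j -> M j0 <= M j.
  by move=> jj0; rewrite leq_mul2r leq_pexp2l ?orbT //; lia.
(* At a fixed scale, consecutive intervals overlap in length [M j], which is at least [P + Q]. *)
have ext j i : j0 <= j -> periodic_on f P lo (M j * (L + 3)) -> L + i <= B ->
    periodic_on f P lo (M j * (L + i + 3)).
  move=> jj0 per; elim: i => [|i IH] iB; first by rewrite addn0.
  have [|Q [Q0 QM perQ]] := loc j (L + i.+1) jj0; first by rewrite leq_addr.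
  have := Mmono _ jj0 => MM.
  apply: (periodic_on_merge Q0 _ _ (IH _) perQ); last by lia.
    by apply: leq_mul => //; lia.
  have -> : M j * (L + i + 3) = M j * (L + i.+1).+1 + M j by nia.
  by lia.
have scale j : j0 <= j -> periodic_on f P lo (M j * (L + 3)).
  move=> jj0; rewrite -(subnKC jj0); elim: (j - j0) => [|i IH].
    by rewrite addn0.
  rewrite addnS; set k := j0 + i in IH *.
  have kj0 : j0 <= k by exact: leq_addr.
  have [||Q [Q0 QM perQ]] := loc k.+1 L; [by lia|by rewrite leqnn LB|].
  have := Mmono _ kj0 => MM.
  have := ext _ (B - L) kj0 IH; rewrite subnKC // => /(_ (leqnn _)) perB.
  apply: (periodic_on_merge Q0 _ _ perB perQ).
    by apply: leq_mul => //; rewrite MS; nia.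
  have -> : M k * (B + 3) = M k.+1 * L.+1 + M k.+1 + M k * 3.
    by rewrite MS /B; nia.
  have := Mmono _ (leqW kj0); lia.
exists lo, P; split=> // n lon.
apply: (scale (j0 + (n + P))) => //; first exact: leq_addr.
apply: (@leq_trans (b ^ (j0 + (n + P)))).
  by apply: leq_ltn_trans (ltn_expl _ b1); exact: leq_addl.
by rewrite /M -mulnA leq_pmulr // muln_gt0 u0; lia.
Qed.

(** Pigeonhole: the ratios [b ^ t / p ^ e t] lie between 1 and [p], a range covered by cells of
    width [1 / N]. Two exponents in one cell give the close pair after cross-multiplication, and
    [indep] rules out equality. *)
Lemma close_powers (p b E : nat) : 1 < p -> 1 < b ->
  (forall t s t' s', b ^ t * p ^ s = b ^ t' * p ^ s' -> t = t') ->
  exists t s t' s', b ^ t * p ^ s < b ^ t' * p ^ s' /\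
    E * (b ^ t' * p ^ s' - b ^ t * p ^ s) <= b ^ t * p ^ s.
Proof.
move=> p1 b1 indep.
pose e t := trunc_log p (b ^ t).
have bt0 t : 0 < b ^ t by rewrite expn_gt0; lia.
have pt0 t : 0 < p ^ t by rewrite expn_gt0; lia.
have eP t : p ^ e t <= b ^ t < p ^ (e t).+1 by apply: trunc_log_bounds.
pose N := E.+1.
have cP t : N * b ^ t %/ p ^ e t < N * p.
  rewrite ltn_divLR // -mulnA -expnS ltn_pmul2l //.
  by case/andP: (eP t).
pose c (t : 'I_(N * p).+1) : 'I_(N * p) := Ordinal (cP t).
have /injectivePn[t [t' tt' ctt']] : ~~ injectiveb c.
  by apply/negP => /injectiveP/leq_card; rewrite !card_ord ltnn.
have {}tt' : (t : nat) != t' by [].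
move/(congr1 val): ctt' => /=; move: tt'.
move: (nat_of_ord t) (nat_of_ord t') => {c}t {}t' tt' cE.
have cell x y : N * b ^ x %/ p ^ e x = N * b ^ y %/ p ^ e y ->
    N * (b ^ y * p ^ e x) <= N * (b ^ x * p ^ e y) + b ^ x * p ^ e y.
  move=> xy; rewrite [N * (b ^ y * _)]mulnA [N * (b ^ x * _)]mulnA.
  have lx := leq_trunc_div (N * b ^ x) (p ^ e x).
  have ly := ltn_ceil (N * b ^ y) (pt0 (e y)).
  rewrite -xy in ly; set k := _ %/ _ in lx ly.
  have /andP[ex _] := eP x.
  apply: (@leq_trans (k.+1 * p ^ e y * p ^ e x)).
    by rewrite leq_mul2r (ltnW ly) orbT.
  rewrite mulSn mulnDl addnC leq_add //.
    by rewrite mulnAC leq_mul2r lx orbT.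
  by rewrite mulnC leq_mul2r ex orbT.
have close x y : x != y -> N * b ^ x %/ p ^ e x = N * b ^ y %/ p ^ e y ->
    b ^ x * p ^ e y < b ^ y * p ^ e x ->
    exists t s t' s', b ^ t * p ^ s < b ^ t' * p ^ s' /\
      E * (b ^ t' * p ^ s' - b ^ t * p ^ s) <= b ^ t * p ^ s.
  move=> xy xyE lt; exists x, (e y), y, (e x); split=> //.
  by have := cell _ _ xyE; rewrite /N; nia.
have [lt|lt|/indep E'] := ltngtP (b ^ t * p ^ e t') (b ^ t' * p ^ e t).
- exact: close lt.
- by apply: close lt; [rewrite eq_sym | symmetry].
- by rewrite E' eqxx in tt'.
Qed.

Lemma eventually_periodic_of_dilation (T : eqType) (p a b : nat)
    (f : nat -> T) (phi : T -> T) :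
  prime p -> 0 < a -> 1 < b -> coprime p b ->
  injective phi -> (forall n, f (p * n) = phi (f n)) ->
  automatic (p ^ a * b) f -> eventually_periodic f.
Proof.
move=> pp a0 b1 pb phiI fp qaut; have p1 := prime_gt1 pp.
have p0 k : 0 < p ^ k by rewrite expn_gt0 prime_gt0.
have b0 k : 0 < b ^ k by rewrite expn_gt0; lia.
set q := p ^ a * b in qaut.
have q1 : 1 < q by have := p0 a; rewrite /q; nia.
have fpk c n : f (p ^ c * n) = iter c phi (f n).
  by elim: c => [|c IH]; rewrite ?mul1n // expnS -mulnA fp IH.
have [F [V VP]] := automatic_classes q1 qaut.
have phicI c : injective (iter c phi).
  by elim: c => [|c IH] x y //= /phiI/IH.
(* Dilation by [p ^ c] acts on values by an injective map, so agreement on blocks of length [q ^ k]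
   descends to blocks of length [M]. *)
pose good M := 0 < M /\ exists c k, M * p ^ c = q ^ k.
have block M : good M -> forall x x', V x = V x' -> forall y, y < M ->
    f (M * x + y) = f (M * x' + y).
  move=> [M0 [c [k MqE]]] x x' /VP VE y yM; apply: (phicI c).
  rewrite -!fpk !mulnDr !mulnA ![p ^ c * M]mulnC MqE; apply: VE.
  by rewrite -MqE mulnC ltn_pmul2r.
pose W x := (V x, V x.+1, V x.+2).
apply: (@periodic_of_blocks _ _ f W b good b1).
  move=> M gM x x' [V0 V1 V2] y y3; have [M0 _] := gM.
  rewrite (divn_eq y M) ![_ + (_ * M + _)]addnA ![_ * M]mulnC -!mulnDr.
  apply: block => //; last by rewrite ltn_mod.
  have : y %/ M < 3 by rewrite ltn_divLR.
  by case: (y %/ M) => [|[|[|//]]] _; rewrite ?addn0 ?addn1 ?addn2.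
have logpb t s : logn p (b ^ t * p ^ s) = s.
  by rewrite lognM // lognX logn_coprime // muln0 add0n pfactorK.
have indep t s t' s' : b ^ t * p ^ s = b ^ t' * p ^ s' -> t = t'.
  move=> eq_ts; have := congr1 (logn p) eq_ts; rewrite !logpb => ss'.
  move: eq_ts; rewrite ss' => /eqP; rewrite eqn_pmul2r //.
  by rewrite eqn_exp2l // => /eqP.
move=> E; have [t [s [t' [s' [uv Euv]]]]] := close_powers E p1 b1 indep.
exists (b ^ t * p ^ s), (b ^ t' * p ^ s'), (s + s'); split=> //.
  by rewrite muln_gt0 b0 p0.
have goodE j x y : y <= j -> good (b ^ j * (b ^ x * p ^ y)).
  move=> yj; split; first by rewrite !muln_gt0 !b0 p0.
  (* The exponent [j + x] matches the power of [b]; [y <= j] and [0 < a] keep the subtraction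
     exact. *)
  exists (a * (j + x) - y), (j + x).
  rewrite !mulnA -expnD -mulnA -expnD subnKC; last by nia.
  by rewrite expnMn mulnC expnM.
by move=> j jj; split; apply: goodE; lia.
Qed.

(** Multiplying [p ^ k * n + r] by a suitable [p ^ c] with [c < a] lands in the [p ^ a]-kernel, and
    [psi] undoes this; only [a] values of [c] occur. *)
Lemma automatic_of_dilation (T : Type) (p a : nat) (f : nat -> T)
    (phi psi : T -> T) :
  1 < p -> 0 < a -> cancel phi psi -> (forall n, f (p * n) = phi (f n)) ->
  automatic (p ^ a) f -> automatic p f.
Proof.
move=> p1 a0 phiK fp aut.
have fpk c n : iter c psi (f (p ^ c * n)) = f n.
  by elim: c n => [|c IH] n; rewrite ?mul1n // iterSr expnS -mulnA fp phiK.
apply: (@sub_finite_set _ _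
  [set (fun n => iter c psi (g n)) | c in `I_a & g in kernel_seq (p ^ a) f]%classic).
  move=> _ [k [r [rk ->]]] /=.
  have [c ca [l kcE]] : exists2 c, c < a & exists l, c + k = a * l.
    (* The outer reduction gives 0, not [a], when [a] divides [k]. *)
    exists ((a - k %% a) %% a); first by rewrite ltn_mod.
    have := divn_eq k a.
    case: (posnP (k %% a)) => [->|m0] kE.
      by rewrite subn0 modnn; exists (k %/ a); rewrite mulnC; lia.
    have ma : k %% a < a by rewrite ltn_mod.
    rewrite modn_small; last by lia.
    by exists (k %/ a).+1; rewrite mulnS mulnC; lia.
  exists c => //; exists (fun n => f ((p ^ a) ^ l * n + p ^ c * r)).
    exists l, (p ^ c * r); split=> //.
    by rewrite -expnM -kcE expnD ltn_pmul2l // expn_gt0; lia.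
  apply/funext => n.
  by rewrite -expnM -kcE expnD -mulnA -mulnDr fpk.
by apply: finite_image2 => //; exact: finite_II.
Qed.

Local Open Scope ring_scope.

Theorem theorem2p10 (R : realType) (q : nat) (f : int -> R[i]) (p : nat) :
  (2 <= q)%N -> mock_character q f ->
  prime p -> (p %| q)%N -> f p%:Z <> 0 ->
  (exists m : nat, (1 <= m)%N /\ q = (p ^ m)%N) /\ mock_character p f.
Proof.
move=> q2 [fM aut nper zeros] pp pq /eqP fp0.
(* Multiplication by the nonzero [f p] serves as the injective [phi]. *)
have fp (n : nat) : f (p * n)%N = f p * f n by rewrite PoszM; exact: fM.2.
have [b pb qE] := pfactor_coprime pp (ltnW q2).
set a := logn p q in qE.
have a0 : (0 < a)%N by rewrite logn_gt0 mem_primes pp pq ltnW.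
rewrite mulnC in qE.
have b1 : b = 1%N.
  have [|] := ltnP 1 b.
    move=> b1; case: nper; rewrite qE in aut.
    exact: (eventually_periodic_of_dilation pp a0 b1 pb (mulfI fp0) fp aut).
  by move: qE q2; case: b {pb} => [|[|//]] // ->; rewrite muln0.
rewrite b1 muln1 in qE; split; first by exists a.
split=> //; rewrite qE in aut.
exact: (automatic_of_dilation (prime_gt1 pp) a0 (mulKf fp0) fp aut).
Qed.
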